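(* Let $\pi:[0,1]^d\to[0,1]$ be a fixed (pre-trained) measurable working model, write $\mathrm{score}(\bm{x})=1-\pi(\bm{x})$, and let $[c_-^*,c_+^*]\subseteq[0,1]$ be an interval (possibly a single point) such that, for $\bm{Z}$ uniformly distributed on $[0,1]^d$, $\mathrm{score}(\bm{Z})$ has a density $f_{\mathrm{score}}$ that is continuous on $[0,c_-^* )$ and on $(c_+^*,1]$, and for some constant $c>0$, $c^{-1}\le f_{\mathrm{score}}(u)\le c$ for a.e. $u\in[0,1]\setminus[c_-^*,c_+^*]$ and $f_{\mathrm{score}}(u)=0$ for a.e. $u\in[c_-^*,c_+^*]$. Let $\alpha>0$ and assume $$\Pr\Bigl(\frac1{n_{\mathrm{cal}}+1}\sum_{i=1}^{n_{\mathrm{cal}}}\ell^{\uparrow}(c_+^*,\bm{x}_i,Y_i)\le\alpha-\frac{3}{n_{\mathrm{cal}}+1}\Bigr)=1,$$ and that the data $(\bm{x}_1,Y_1),\dots,(\bm{x}_{n_{\mathrm{cal}}},Y_{n_{\mathrm{cal}}}),(\bm{x}_{n_{\mathrm{cal}}+1},Y_{n_{\mathrm{cal}}+1})$ are i.i.d. Let $$\widehat{\lambda}^\diamond=\sup\Bigl\{\lambda\in[c_+^*,1]\;:\;\frac1{n_{\mathrm{cal}}+1}\sum_{i=1}^{n_{\mathrm{cal}}}\ell^{\uparrow}(\lambda,\bm{x}_i,Y_i)+\frac{2}{n_{\mathrm{cal}}+1}\le\alpha\Bigr\}.$$ Then $$\mathbb{E}\{\mathcal{R}_1(\widehat{\l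ambda}^\diamond)\}\le\mathbb{E}\Bigl\{\sup_{c_+^*\le\gamma\le\widehat{\lambda}^\diamond}\ell(\gamma,\bm{x}_{n_{\mathrm{cal}}+1},Y_{n_{\mathrm{cal}}+1})\Bigr\}\le\alpha.$$
   Context: The pair $(\bm{x},Y)$ is random: $\bm{x}$ is uniformly distributed on $[0,1]^d$ and, given $\bm{x}$, $Y\in\{0,1\}$ is Bernoulli with success probability $\Pr(Y=1\mid\bm{x})$; all pairs $(\bm{x}_i,Y_i)$, $i=1,\dots,n_{\mathrm{cal}}+1$, have this distribution. For a fixed $p_R\in(0,1)$ the reliability set is $\mathcal{X}_R=\{\bm{x}\in[0,1]^d : \Pr(Y=1\mid\bm{x})\ge p_R\}$. It is assumed that $\mathcal{X}_R$ and its complement both have positive Lebesgue measure and that $\{\bm{x}:\Pr(Y=1\mid\bm{x})=p_R\}$ has Lebesgue measure zero. For a scalar $\lambda$ put $\hat{\mathcal{X}}_R(\lambda)=\{\bm{x}\in[0,1]^d:\pi(\bm{x})\ge 1-\lambda\}$. The loss is $\ell(\lambda,\bm{x},Y)=\mathbb{I}(\pi(\bm{x})\ge 1-\lambda,\,Y=0)+(1-p_R)\,\mathbb{I}(\pi(\bm{x})<1-\lambda)$, and its monotone refinement is $\ell^{\uparrow}(\lambda,\bm{x},Y)=\sup_{c_+^*\le\gamma\le\lambda}\ell(\gamma,\bm{x},Y)$ for $\lambda\in[c_+^*,1]$. For a threshold $\lambda$ computed from the calibration data $(\bm{x}_i,Y_i)$, $i\le n_{\mathrm{cal}}$, the expected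 type I risk is $$\mathbb{E}\{\mathcal{R}_1(\lambda)\}=\mathbb{E}\bigl\{(p_R-Y_{n_{\mathrm{cal}}+1})\,\mathbb{I}(\bm{x}_{n_{\mathrm{cal}}+1}\in\hat{\mathcal{X}}_R(\lambda),\,\bm{x}_{n_{\mathrm{cal}}+1}\notin\mathcal{X}_R)\bigr\},$$ the expectation being over both the calibration data and the test pair. *)

(* Defs.v *)
From HB Require Import structures.
From mathcomp Require Import all_boot all_order all_algebra.
From mathcomp Require Import all_classical all_reals all_analysis.

Set Implicit Arguments.
Unset Strict Implicit.
Unset Printing Implicit Defensive.
Import Order.TTheory GRing.Theory Num.Theory.
Import numFieldNormedType.Exports.

Local Open Scope classical_set_scope.
Local Open Scope ring_scope.

Section lebesgue_tuple.
Variable R : realType.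
Local Open Scope ereal_scope.

Section step.
Variables (n : nat) (m : {sigma_finite_measure set (n.-tuple R) -> \bar R}).

Definition tuple_cons (z : measurableTypeR R * n.-tuple R) : n.+1.-tuple R :=
  [tuple of z.1 :: z.2].

Definition tuple_uncons (t : n.+1.-tuple R) : measurableTypeR R * n.-tuple R :=
  (thead t, [tuple of behead t]).

Lemma tuple_consK : cancel tuple_cons tuple_uncons.
Proof.
by case=> a t; rewrite /tuple_uncons /tuple_cons /= theadE; congr pair; exact: val_inj.
Qed.

Lemma measurable_tuple_cons : measurable_fun [set: _] tuple_cons.
Proof. exact: measurable_cons. Qed.

Lemma measurable_tuple_uncons : measurable_fun [set: _] tuple_uncons.
Proof.
apply/measurable_fun_pair; first exact: measurable_tnth.
exact: measurable_behead.
Qed.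

Definition lebesgue_cons : set (n.+1.-tuple R) -> \bar R :=
  pushforward (@lebesgue_measure R \x m) tuple_cons.

Let lebesgue_cons0 : lebesgue_cons set0 = 0.
Proof. by rewrite /lebesgue_cons /pushforward preimage_set0 measure0. Qed.

Let lebesgue_cons_ge0 A : 0 <= lebesgue_cons A.
Proof. by rewrite /lebesgue_cons /pushforward measure_ge0. Qed.

Let lebesgue_cons_sigma_additive : semi_sigma_additive lebesgue_cons.
Proof.
move=> F mF tF mUF; rewrite /lebesgue_cons /pushforward preimage_bigcup.
have mcons A : measurable A -> measurable (tuple_cons @^-1` A).
  by move=> mA; rewrite -[X in measurable X]setTI; exact: measurable_tuple_cons.
apply: measure_semi_sigma_additive.
- by move=> k; exact: mcons.
- apply/trivIsetP => /= i j _ _ ij; rewrite -preimage_setI.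
  by move/trivIsetP : tF => /(_ _ _ _ _ ij) ->//; rewrite preimage_set0.
- by rewrite -preimage_bigcup; exact: mcons.
Qed.

HB.instance Definition _ := isMeasure.Build _ _ _ lebesgue_cons
  lebesgue_cons0 lebesgue_cons_ge0 lebesgue_cons_sigma_additive.

Lemma lebesgue_cons_sigma_finite : sigma_finite [set: _] lebesgue_cons.
Proof.
have /sigma_finiteP[F [TF ndF Foo]] := sigma_finiteT (@lebesgue_measure R).
have /sigma_finiteP[G [TG ndG Goo]] := sigma_finiteT m.
exists (fun k => tuple_uncons @^-1` (F k `*` G k)).
  rewrite -preimage_bigcup (_ : \bigcup_k _ = setT) ?preimage_setT//.
  apply/seteqP; split => // -[x y] _.
  have [i _ Fx] : (\bigcup_k F k) x by rewrite -TF.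
  have [j _ Gy] : (\bigcup_k G k) y by rewrite -TG.
  exists (maxn i j) => //; split.
    by move: (x) Fx; exact/subsetPset/ndF/leq_maxl.
  by move: (y) Gy; exact/subsetPset/ndG/leq_maxr.
move=> k; have [mF Fk] := Foo k; have [mG Gk] := Goo k; split.
  rewrite -[X in measurable X]setTI; apply: measurable_tuple_uncons => //.
  exact: measurableX.
rewrite /lebesgue_cons /pushforward -comp_preimage.
rewrite (_ : _ \o _ = id) ?preimage_id; last exact/funext/tuple_consK.
by rewrite product_measure1E// lte_mul_pinfty// ge0_fin_numE.
Qed.

HB.instance Definition _ := Measure_isSigmaFinite.Build _ _ _ lebesgue_cons
  lebesgue_cons_sigma_finite.

End step.

(* Lebesgue measure on R^n (Borel sets), as an n-fold iterated product of the
   one-dimensional one; [lebesgue_tuple_box] gives its value on boxes. *)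
Fixpoint lebesgue_tuple (n : nat) :
    {sigma_finite_measure set (n.-tuple R) -> \bar R} :=
  match n with
  | 0%N => \d_([tuple] : 0.-tuple R)
  | n'.+1 => lebesgue_cons (lebesgue_tuple n')
  end.

Lemma lebesgue_tuple_box (n : nat) (A : 'I_n -> set R) :
  (forall i, measurable (A i)) ->
  lebesgue_tuple n [set t | forall i, A i (tnth t i)] =
  \prod_(i < n) lebesgue_measure (A i).
Proof.
elim: n A => [|n IHn] A mA /=.
  by rewrite big_ord0 diracE mem_set// => -[].
rewrite big_ord_recl -IHn//.
rewrite -(product_measure1E _ (lebesgue_tuple n)); [|exact: mA|]; last first.
  rewrite (_ : mkset _ = \bigcap_(i in [set: 'I_n])
    ((fun t : n.-tuple R => tnth t i) @^-1` A (lift ord0 i))).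
    apply: fin_bigcap_measurable => // i _.
    by rewrite -[X in measurable X]setTI; exact: measurable_tnth.
  by apply/seteqP; split => [t At i _|t At i]; exact: At.
set B := _ `*` _; suff -> : B = @tuple_cons n @^-1`
  [set t | forall i, A i (tnth t i)] by [].
apply/seteqP; split => -[a t] /= At; last first.
  split; first by have := At ord0.
  by move=> i; have := At (lift ord0 i); rewrite tnthS.
move=> i; case: (unliftP ord0 i) => [j|] ->; last exact: At.1.
by rewrite tnthS; exact: At.2.
Qed.

End lebesgue_tuple.

Section probability_notions.
Context d (Omega : measurableType d) (R : realType) (P : probability Omega R).
Local Open Scope ereal_scope.

Definition mutually_independent d' (T : measurableType d') (I : finType)
    (Z : I -> Omega -> T) : Prop :=
  forall (J : {set I}) (A : I -> set T), (forall i, measurable (A i)) ->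
    P (\bigcap_(i in [set` J]) (Z i @^-1` A i)) =
    \prod_(i in J) P (Z i @^-1` A i).

Definition identically_distributed d' (T : measurableType d') (I : Type)
    (Z : I -> Omega -> T) : Prop :=
  forall (i j : I) (A : set T), measurable A ->
    P (Z i @^-1` A) = P (Z j @^-1` A).

Definition iid d' (T : measurableType d') (I : finType)
    (Z : I -> Omega -> T) : Prop :=
  mutually_independent Z /\ identically_distributed Z.

End probability_notions.

Section unit_cube.
Context (R : realType) (d : nat).

Definition unit_cube : set (d.-tuple R) :=
  [set x | forall j, 0 <= tnth x j <= 1].

Definition uniform_cube (A : set (d.-tuple R)) : \bar R :=
  lebesgue_tuple R d (A `&` unit_cube).

Context d' (Omega : measurableType d') (P : probability Omega R).

(* Random vectors with values in [0,1]^d are maps to R^d whose range is included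
   in the cube; functions on [0,1]^d are maps on R^d of which only the
   restriction to the cube matters. *)
Definition uniform_on_cube (X : Omega -> d.-tuple R) : Prop :=
  (forall w, unit_cube (X w)) /\
  (forall A, measurable A -> P (X @^-1` A) = uniform_cube A).

(* [eta] is (a version of) x |-> Pr(Y = 1 | x): a measurable [0,1]-valued function
   whose integral over each event {X \in A} is Pr(X \in A, Y = 1). *)
Definition success_probability (eta : d.-tuple R -> R)
    (X : Omega -> d.-tuple R) (Y : Omega -> bool) : Prop :=
  [/\ measurable_fun unit_cube eta,
      (forall x, unit_cube x -> 0 <= eta x <= 1) &
      (forall A, measurable A ->
         P (X @^-1` A `&` Y @^-1` [set true]) =
         (\int[P]_(w in X @^-1` A) (eta (X w))%:E)%E)].

(* [f] is a density on [0,1] of s(Z), for Z uniformly distributed on the cube. *)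
Definition density_on_unit_interval (s : d.-tuple R -> R) (f : R -> R) : Prop :=
  [/\ measurable_fun (`[0, 1] : set R) f,
      (forall u, u \in `[0, 1] -> 0 <= f u) &
      (forall B : set R, measurable B ->
         uniform_cube (s @^-1` B) =
         (\int[lebesgue_measure]_(u in B `&` (`[0%R, 1%R] : set R)) (f u)%:E)%E)].

End unit_cube.

Section reliability.
Context (R : realType) (d : nat).
Implicit Types (x : d.-tuple R) (y : bool) (l : R).

Definition reliability_set (eta : d.-tuple R -> R) (pR : R) : set (d.-tuple R) :=
  [set x | unit_cube x /\ pR <= eta x].

Variable pi : d.-tuple R -> R.

Definition score x : R := 1 - pi x.

Definition estimated_set l : set (d.-tuple R) :=
  [set x | unit_cube x /\ 1 - l <= pi x].

Variable pR : R.

Definition loss l x y : R :=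
  ((1 - l <= pi x)%R && (y == false))%:R + (1 - pR) * (pi x < 1 - l)%R%:R.

Variable cplus : R.

Definition monotone_loss l x y : R :=
  sup [set loss g x y | g in `[cplus, l]].

Variable n : nat.
Implicit Types (xs : 'I_n -> d.-tuple R) (ys : 'I_n -> bool).

Definition calibration_loss xs ys l : R :=
  n.+1%:R^-1 * \sum_(i < n) monotone_loss l (xs i) (ys i).

Definition lambda_hat (alpha : R) xs ys : R :=
  sup [set l | l \in `[cplus, 1] /\
    calibration_loss xs ys l + 2%:R / n.+1%:R <= alpha].

End reliability.

Section calibrated_threshold.
Context (R : realType) (d n : nat) d' (Omega : measurableType d')
  (P : probability Omega R).

(* The first [n] of the [n.+1] observations; the last one is the test point. *)
Definition calibration_data d'' (T : measurableType d'')
    (Z : 'I_n.+1 -> {RV P >-> T}) (w : Omega) : 'I_n -> T :=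
  fun i => Z (widen_ord (leqnSn n) i) w.

Definition lambda_diamond (pi : d.-tuple R -> R) (pR cplus alpha : R)
    (X : 'I_n.+1 -> {RV P >-> d.-tuple R}) (Y : 'I_n.+1 -> {RV P >-> bool})
    (w : Omega) : R :=
  lambda_hat pi pR cplus alpha (calibration_data X w) (calibration_data Y w).

End calibrated_threshold.

Definition expected_type1_risk (R : realType) (d : nat) d'
    (Omega : measurableType d') (P : probability Omega R)
    (pi eta : d.-tuple R -> R) (pR : R) (lambda : Omega -> R)
    (X : Omega -> d.-tuple R) (Y : Omega -> bool) : \bar R :=
  'E_P[fun w => ((pR - (Y w)%:R) *
    \1_(estimated_set pi (lambda w) `&` ~` reliability_set eta pR) (X w))%R]%E.

(* Main.v *)
Require Import Defs.
From HB Require Import structures.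
From mathcomp Require Import all_boot all_order all_algebra.
From mathcomp Require Import fingroup perm.
From mathcomp Require Import all_classical all_reals all_analysis measurable_realfun.
From mathcomp Require Import ring lra.

Set Implicit Arguments.
Unset Strict Implicit.
Unset Printing Implicit Defensive.
Import Order.TTheory GRing.Theory Num.Theory.
Import numFieldNormedType.Exports.

Local Open Scope classical_set_scope.
Local Open Scope ring_scope.

(** The argument is a leave-one-out version of conformal risk control.

    A point enters the losses only through its score s and its label. For
    thresholds l >= cplus the monotone loss is its value at cplus, plus pR if
    s lies in ]cplus, l] and the label is 0 (monotone_lossE): as a function of l it
    has at most one jump, of size pR, located at s. Consequently the total
    calibration loss is a step function. When its value at cplus is within the budget
    B = (n + 1) alpha - 2, which almost surely happens, the calibrated threshold
    reaches a score u > cplus if and only if the loss accumulated strictly below u is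
    within this budget (le_lambda_hat). The loss of the test point at
    the calibrated threshold is thereby an explicit function of the n + 1
    observations, held_out_loss.

    Observations that are independent and identically distributed are exchangeable
    (iid_exchangeable), so the expected test loss is the average over j of the
    expected loss of observation j when j is held out and the others calibrate.
    The sum of these n + 1 losses is at most B + 1 pointwise in the absence of ties
    (sum_held_out_loss_le): the observation with the largest score among those whose
    held-out loss jumps has, in its own calibration sum, every other jump, so the
    others together cost at most B, and it costs at most 1 itself. Ties between
    scores have probability zero because the score has a bounded density
    (ties_negligible). Hence the expected loss is at most (B + 1) / (n + 1), which
    is less than alpha.

    The type I risk is dominated by the loss pointwise, for almost every outcome
    (type1_risk_le_loss), since selecting a point of label 0 costs 1 >= pR and
    selecting a point of label 1 has nonpositive risk. *)

(** * Exchangeability of independent, identically distributed observations *)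

Section measurable_boxes.
Context d (T : measurableType d) (n : nat).

Definition tuple_boxes : set (set (n.-tuple T)) :=
  [set [set t | forall i, A i (tnth t i)] | A in
    [set A : 'I_n -> set T | forall i, measurable (A i)]].

Lemma setI_closed_tuple_boxes : setI_closed tuple_boxes.
Proof.
move=> _ _ [A mA <-] [B mB <-]; exists (fun i => A i `&` B i).
  by move=> i; exact: measurableI.
apply/seteqP; split => t /=; first by move=> tAB; split=> i; have [] := tAB i.
by move=> [tA tB] i; split.
Qed.

Lemma measurable_tuple_boxesE :
  (measurable : set (set (n.-tuple T))) = <<s tuple_boxes >>.
Proof.
apply/seteqP; split.
  apply: smallest_sub; first exact: smallest_sigma_algebra.
  move=> B; rewrite -bigcup_seq/= => -[i _ [A mA <-]].
  apply: sub_sigma_algebra.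
  exists (fun j => if j == i then A else setT).
    by move=> j; case: ifP.
  apply/seteqP; split => t /=.
    by move=> /(_ i); rewrite eqxx.
  by move=> [_ tA] j; case: eqP => // ->.
apply: smallest_sub; first exact: sigma_algebra_measurable.
move=> _ [A mA <-].
rewrite (_ : mkset _ = \bigcap_(i in [set: 'I_n])
    ((fun t : n.-tuple T => tnth t i) @^-1` A i)).
  apply: fin_bigcap_measurable => // i _.
  by rewrite -[X in measurable X]setTI; exact: measurable_tnth.
by apply/seteqP; split => [t At i _|t At i]; exact: At.
Qed.

End measurable_boxes.

Section exchangeability.
Context d (Omega : measurableType d) (R : realType) (P : probability Omega R).
Context d' (T : measurableType d') (n : nat).
Variable Z : 'I_n -> Omega -> T.
Hypothesis mZ : forall i, measurable_fun setT (Z i).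

Definition sample (s : {perm 'I_n}) (w : Omega) : n.-tuple T :=
  [tuple Z (s i) w | i < n].

Lemma measurable_sample s : measurable_fun setT (sample s).
Proof.
apply/measurable_fun_tnthP => i.
rewrite (_ : _ \o _ = Z (s i)); first exact: mZ.
by apply/funext => w /=; rewrite tnth_mktuple.
Qed.

Hypothesis iidZ : iid P Z.

Lemma iid_box (s : {perm 'I_n}) (A : 'I_n -> set T) :
  (forall i, measurable (A i)) ->
  P (sample s @^-1` [set t | forall i, A i (tnth t i)]) =
  (\prod_(i < n) P (Z i @^-1` A i))%E.
Proof.
move=> mA; have [indZ idZ] := iidZ.
have -> : sample s @^-1` [set t | forall i, A i (tnth t i)] =
    \bigcap_(i in [set` [set: 'I_n]%SET]) (Z i @^-1` A (s^-1 i)%g).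
  apply/seteqP; split => w /=.
    move=> wA i _; have := wA (s^-1 i)%g.
    by rewrite tnth_mktuple permKV.
  move=> wA i; rewrite tnth_mktuple.
  by have := wA (s i); rewrite /= permK; apply; rewrite inE.
rewrite indZ => [|i]; last exact: mA.
rewrite (reindex_inj (@perm_inj _ s))/=.
apply: eq_big => [i|i _]; first by rewrite inE.
by rewrite permK; exact: idZ.
Qed.

(** Boxes form a pi-system generating the product sigma-algebra, and the law
    of the sample gives to a box a product of marginal probabilities, which
    does not see the order of the observations. *)
Lemma iid_exchangeable (s : {perm 'I_n}) (h : n.-tuple T -> \bar R) :
  measurable_fun [set: n.-tuple T] h -> (forall t, 0 <= h t)%E ->
  (\int[P]_w h (sample s w) = \int[P]_w h (sample 1 w))%E.
Proof.
move=> mh h0.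
have ms := measurable_sample.
transitivity (\int[pushforward P (sample s)]_t h t)%E.
  by rewrite (ge0_integral_pushforward (ms s)).
transitivity (\int[pushforward P (sample 1)]_t h t)%E; last first.
  by rewrite (ge0_integral_pushforward (ms 1%g)).
apply: eq_measure_integral => B mB _.
apply: (measure_unique (@tuple_boxes _ T n) (fun=> setT)) => //.
- exact: measurable_tuple_boxesE.
- exact: setI_closed_tuple_boxes.
- by move=> _; exists (fun=> setT) => //; apply/seteqP; split.
- by rewrite bigcup_const.
- by move=> _ [A mA <-]; rewrite /= /pushforward !iid_box.
- by move=> _; rewrite /= /pushforward preimage_setT probability_setT ltry.
Qed.

End exchangeability.

(** * The leave-one-out bound *)

Section loss_below.
Context (R : realType) (I : finType).
Variables (b s : I -> R) (m : pred I) (p : R).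

Definition loss_below (J : pred I) (u : R) : R :=
  \sum_(i | J i) (b i + p * (m i && (s i < u))%:R).

(** The loss of [j] at the threshold calibrated on all the other observations,
    [B] being the budget of the calibration losses: that threshold reaches the
    score of [j] if and only if the thresholds strictly below this score keep the
    other losses within budget, whence the strict inequality in [loss_below]. *)
Definition held_out_loss (B : R) (j : I) : R :=
  b j + p * (m j && (loss_below (predC1 j) (s j) <= B))%:R.

(** Among the indices whose own loss jumps when they are held out, the one with
    the largest score sees, by absence of ties, all the other jumps in its
    calibration sum; that sum is within budget, and one more loss costs at
    most 1. *)
Lemma sum_held_out_loss_le (B : R) (i0 : I) :
  0 <= p -> (forall i, b i <= 1) -> (forall i, m i -> b i + p <= 1) ->
  (forall i j, i != j -> m i -> m j -> s i != s j) ->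
  \sum_(i | i != i0) b i <= B ->
  \sum_j held_out_loss B j <= B + 1.
Proof.
move=> p0 b1 bp1 noties calB.
pose sel j := m j && (loss_below (predC1 j) (s j) <= B).
case: (pickP sel) => [j0 selj0|nosel]; last first.
  rewrite (bigD1 i0)//= addrC /held_out_loss; apply: lerD.
    rewrite (le_trans _ calB)//; apply: ler_sum => i _.
    by rewrite -/(sel i) nosel mulr0 addr0.
  by rewrite -/(sel i0) nosel mulr0 addr0.
case: (@Order.TotalTheory.arg_maxP _ _ I j0 sel s selj0) => j selj maxj.
rewrite (bigD1 j)//= addrC; apply: lerD; last first.
  by rewrite /held_out_loss -/(sel j) selj mulr1 bp1//; case/andP: selj.
have [mj] := andP selj; apply: le_trans.
rewrite /loss_below; apply: ler_sum => i ij; rewrite lerD2l ler_wpM2l//.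
rewrite -/(sel i); have [seli|_] := boolP (sel i); last exact: ler0n.
have [mi _] := andP seli.
have sij : s i <= s j := maxj _ seli.
by rewrite mi/= lt_neqAle noties//= sij.
Qed.

End loss_below.

Lemma measurable_natr_bool d (T : measurableType d) (R : realType)
    (g : T -> bool) :
  measurable_fun setT g -> measurable_fun setT (fun x => (g x)%:R : R).
Proof.
move=> mg; rewrite (_ : (fun x => _) = fun x => if g x then 1 else 0).
  by apply: measurable_fun_ifT => //; exact: measurable_cst.
by apply/funext => x; case: (g x).
Qed.

Lemma measurable_sum_cond d (T : measurableType d) (R : realType) (I : finType)
    (J : pred I) (h : I -> T -> R) :
  (forall i, J i -> measurable_fun setT (h i)) ->
  measurable_fun setT (fun x => \sum_(i | J i) h i x).
Proof.
move=> mh.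
rewrite (_ : (fun x => _) = fun x => \sum_i if J i then h i x else 0).
  apply: measurable_sum => i; have [/mh//|_] := boolP (J i); exact: measurable_cst.
by apply/funext => x; exact: big_mkcond.
Qed.

Section expected_held_out_loss.
Context d (Omega : measurableType d) (R : realType) (P : probability Omega R).
Context d' (T : measurableType d') (n : nat).
Variable Z : 'I_n.+1 -> Omega -> T.
Hypothesis mZ : forall i, measurable_fun setT (Z i).
Hypothesis iidZ : iid P Z.
Variables (b s : T -> R) (m : T -> bool) (p B : R).
Hypotheses (mb : measurable_fun setT b) (ms : measurable_fun setT s)
  (mm : measurable_fun setT m).

Definition loss_below_of (t : n.+1.-tuple T) (j : 'I_n.+1) : R :=
  loss_below (fun i => b (tnth t i)) (fun i => s (tnth t i))
    (fun i => m (tnth t i)) p (predC1 j) (s (tnth t j)).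

Definition held_out_loss_of (t : n.+1.-tuple T) (j : 'I_n.+1) : R :=
  held_out_loss (fun i => b (tnth t i)) (fun i => s (tnth t i))
    (fun i => m (tnth t i)) p B j.

Lemma measurable_loss_below_of j :
  measurable_fun [set: n.+1.-tuple T] (loss_below_of ^~ j).
Proof.
apply: measurable_sum_cond => i _.
apply: measurable_funD; first exact: (measurableT_comp mb (measurable_tnth i)).
apply: measurable_funM; first exact: measurable_cst.
apply: measurable_natr_bool; apply: measurable_and.
  exact: (measurableT_comp mm (measurable_tnth i)).
by apply: measurable_fun_ltr;
  [exact: (measurableT_comp ms (measurable_tnth i))
  |exact: (measurableT_comp ms (measurable_tnth j))].
Qed.

Lemma measurable_held_out_loss_of j :
  measurable_fun [set: n.+1.-tuple T] (held_out_loss_of ^~ j).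
Proof.
apply: measurable_funD; first exact: (measurableT_comp mb (measurable_tnth j)).
apply: measurable_funM; first exact: measurable_cst.
apply: measurable_natr_bool; apply: measurable_and.
  exact: (measurableT_comp mm (measurable_tnth j)).
apply: measurable_fun_ler; last exact: measurable_cst.
exact: measurable_loss_below_of.
Qed.

Lemma held_out_loss_of_tperm j w :
  held_out_loss_of (sample Z (tperm j ord_max) w) ord_max =
  held_out_loss_of (sample Z 1 w) j.
Proof.
rewrite /held_out_loss_of /held_out_loss !tnth_mktuple !perm1 tpermR.
congr (_ + _ * (_ && (_ <= _))%:R).
rewrite /loss_below (reindex_inj (@perm_inj _ (tperm j ord_max)))/=.
apply: eq_big => [i|i _].
  by rewrite /= (can2_eq (tpermK _ _) (tpermK _ _)) tpermR.
by rewrite !tnth_mktuple !perm1 tpermK.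
Qed.

Hypotheses (p0 : 0 <= p) (b0 : forall x, 0 <= b x) (b1 : forall x, b x <= 1)
  (bp1 : forall x, m x -> b x + p <= 1).
Hypothesis noties : forall i j, i != j ->
  P.-negligible [set w | s (Z i w) = s (Z j w)].
Hypothesis calB : {ae P, forall w, \sum_(i | i != ord_max) b (Z i w) <= B}.

Local Open Scope ereal_scope.

(** By exchangeability the expected loss of the last observation is the average,
    over all the ways of choosing the held-out observation, of its expected
    held-out loss. *)
Lemma expectation_held_out_loss_le :
  \int[P]_w (held_out_loss_of (sample Z 1 w) ord_max)%:E
    <= ((B + 1) / n.+1%:R)%:E.
Proof.
have h0 t j : (0 <= held_out_loss_of t j)%R.
  by rewrite addr_ge0// mulr_ge0.
have mh j : measurable_fun setT
    (fun w => (held_out_loss_of (sample Z 1 w) j)%:E).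
  apply/measurable_EFinP.
  exact: (measurableT_comp (measurable_held_out_loss_of j)
    (measurable_sample mZ 1)).
have exch j : \int[P]_w (held_out_loss_of (sample Z 1 w) j)%:E =
    \int[P]_w (held_out_loss_of (sample Z 1 w) ord_max)%:E.
  under eq_integral do rewrite -held_out_loss_of_tperm.
  apply: (iid_exchangeable mZ iidZ (tperm j ord_max)
    (h := fun t => (held_out_loss_of t ord_max)%:E)).
    by apply/measurable_EFinP; exact: measurable_held_out_loss_of.
  by move=> t; rewrite lee_fin.
suff sum_le : \sum_(j < n.+1) \int[P]_w (held_out_loss_of (sample Z 1 w) j)%:E
    <= (B + 1)%:E.
  move: sum_le; under eq_bigr do rewrite exch.
  set x := integral _ _ _ => sum_le.
  rewrite EFinM lee_pdivlMr// muleC; apply: le_trans sum_le.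
  under eq_bigr do rewrite -[x]mul1e.
  by rewrite -ge0_sume_distrl// sumEFin sumr_const card_ord.
have : \forall w \ae P, (\sum_j held_out_loss_of (sample Z 1 w) j <= B + 1)%R.
  have : \forall w \ae P, forall i j, i != j -> s (Z i w) != s (Z j w).
    apply: filter_forall => i; apply: filter_forall => j.
    have [->|ij] := eqVneq i j; first exact: aeW.
    apply: negligibleS (noties ij) => w /= /not_implyP[_] /negP.
    by rewrite negbK => /eqP.
  apply: filterS2 calB => w calw notw.
  apply: (@sum_held_out_loss_le _ _ _ _ _ _ _ ord_max) => //.
  - by move=> i /bp1.
  - by move=> i j ij _ _; rewrite !tnth_mktuple !perm1 notw.
  - by rewrite (le_trans _ calw)//; apply: ler_sum => i _;
      rewrite tnth_mktuple perm1.
move=> sum_le; rewrite -ge0_integral_sum//; last first.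
  by move=> j w _; rewrite lee_fin.
have B1 : (0 <= B + 1)%R.
  have P0 : 0 < P setT by rewrite probability_setT lte01.
  have PF := ae_properfilter_algebraOfSetsType P0.
  have [w] := filter_ex sum_le.
  by apply: le_trans; exact: sumr_ge0.
apply: (@le_trans _ _ (\int[P]_w (B + 1)%:E)).
  apply: ae_ge0_le_integral => //.
  - by move=> w _; apply: sume_ge0 => j _; rewrite lee_fin.
  - exact: emeasurable_sum.
  - by apply: filterS sum_le => w wle _; rewrite sumEFin lee_fin.
by rewrite integral_cst//= probability_setT mule1.
Qed.

End expected_held_out_loss.

(** * The monotone loss and the calibrated threshold *)

Section threshold.
Context (R : realType) (d : nat).
Variables (pi : d.-tuple R -> R) (pR cplus : R).
Hypothesis pR01 : 0 <= pR <= 1.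

Definition score_label (x : d.-tuple R) (y : bool) : measurableTypeR R * bool :=
  (score pi x, y).

(** The loss at the threshold [cplus], as a function of the score and the label. *)
Definition base_loss (z : measurableTypeR R * bool) : R :=
  ((z.1 <= cplus) && ~~ z.2)%:R + (1 - pR) * (cplus < z.1)%R%:R.

(** The points whose monotone loss increases (by [pR]) when the threshold
    reaches their score. *)
Definition jumps (z : measurableTypeR R * bool) : bool :=
  (cplus < z.1) && ~~ z.2.

Lemma base_loss_ge0 z : 0 <= base_loss z.
Proof. by rewrite addr_ge0 ?mulr_ge0// subr_ge0; case/andP: pR01. Qed.

Lemma base_loss_le1 z : base_loss z <= 1.
Proof.
rewrite /base_loss; case: (lerP z.1 cplus) => _ /=; last by case/andP: pR01; lra.
by rewrite mulr0 addr0; case: z.2; rewrite /= ?ler01.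
Qed.

Lemma base_loss_jumps z : jumps z -> base_loss z = 1 - pR.
Proof.
by rewrite /jumps /base_loss ltNge; case: lerP => //= _ _; rewrite add0r mulr1.
Qed.

Lemma lossE g x y : loss pi pR g x y =
  ((score pi x <= g) && ~~ y)%:R + (1 - pR) * (g < score pi x)%R%:R.
Proof.
by rewrite /loss /score lerBlDr -lerBlDl ltrBrDr -ltrBrDl; case: y.
Qed.

(** As the threshold grows from [cplus], the loss at a point of score above [cplus]
    changes only when the threshold reaches the score: it then moves from [1 - pR]
    to 1 (label 0) or to 0 (label 1), and the supremum keeps only the upward move.
    The loss at a point of score at most [cplus] does not change. *)
Lemma monotone_lossE l x y : cplus <= l ->
  monotone_loss pi pR cplus l x y = base_loss (score_label x y)
    + pR * (jumps (score_label x y) && (score pi x <= l))%:R.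
Proof.
move=> cl; rewrite /base_loss /jumps /score_label /=.
set s := score pi x; set M := (X in _ = X).
have [pR0 pR1] := andP pR01.
have ubM : ubound [set loss pi pR g x y | g in `[cplus, l]] M.
  move=> z [g /=]; rewrite in_itv/= => /andP[cg gl] <-; rewrite lossE -/s /M.
  clear M; case: y; case: (lerP s g) => sg; case: (lerP s cplus) => sc;
    case: (lerP s l) => sl; rewrite /=; lra.
(* the supremum is attained at the score if the loss jumps there, else at cplus *)
have memM : [set loss pi pR g x y | g in `[cplus, l]] M.
  exists (if jumps (score_label x y) && (s <= l) then s else cplus).
    rewrite /= in_itv/= /jumps/= -/s; case: ifP; last by rewrite lexx.
    by move=> /andP[/andP[/ltW -> _] ->].
  rewrite lossE -/s /M /jumps/= -/s.
  clear ubM M; case: y; case: (lerP s cplus) => sc;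
    case: (lerP s l) => sl; rewrite /= ?lexx ?ltxx ?sc//=;
    try (rewrite leNgt sc /=); try (rewrite ltNge sc/=); try lra.
apply/eqP; rewrite eq_le; apply/andP; split.
  by apply: ge_sup => //; exists M.
by apply: ub_le_sup => //; exists M.
Qed.

Lemma monotone_loss_ge0 l x y : 0 <= monotone_loss pi pR cplus l x y.
Proof.
have [cl|lc] := leP cplus l.
  rewrite monotone_lossE// addr_ge0 ?base_loss_ge0// mulr_ge0//.
  by case/andP: pR01.
rewrite /monotone_loss (_ : [set` `[cplus, l]] = set0) ?image_set0 ?sup0//.
by apply: set_itv_ge; rewrite bnd_simp -ltNge.
Qed.

End threshold.

Section calibrated_threshold_value.
Context (R : realType) (d n : nat).
Variables (pi : d.-tuple R -> R) (pR cplus alpha : R).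
Hypothesis pR01 : 0 <= pR <= 1.
Hypothesis cplus1 : cplus <= 1.
Variables (xs : 'I_n -> d.-tuple R) (ys : 'I_n -> bool).

Let z i := score_label pi (xs i) (ys i).
Let base i := base_loss pR cplus (z i).
Let below u := loss_below base (fun i => (z i).1)
  (fun i => jumps cplus (z i)) pR predT u.
Let B : R := n.+1%:R * alpha - 2.

Lemma calibration_loss_leE (l k : R) :
  (calibration_loss pi pR cplus xs ys l + k / n.+1%:R <= alpha) =
  (\sum_i monotone_loss pi pR cplus l (xs i) (ys i) <= n.+1%:R * alpha - k).
Proof.
rewrite /calibration_loss (mulrC _^-1) -mulrDl ler_pdivrMr// lerBrDr.
by rewrite (mulrC alpha).
Qed.

Lemma sum_monotone_lossE l : cplus <= l ->
  \sum_i monotone_loss pi pR cplus l (xs i) (ys i) =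
  \sum_i (base i + pR * (jumps cplus (z i) && ((z i).1 <= l))%:R).
Proof. by move=> cl; apply: eq_bigr => i _; rewrite monotone_lossE. Qed.

Lemma sum_monotone_loss_cplus :
  \sum_i monotone_loss pi pR cplus cplus (xs i) (ys i) = \sum_i base i.
Proof.
rewrite sum_monotone_lossE//; apply: eq_bigr => i _.
by rewrite /jumps; case: (lerP (z i).1 cplus); rewrite ?andbF/= mulr0 addr0.
Qed.

Let feasible := [set l | l \in `[cplus, 1] /\
  calibration_loss pi pR cplus xs ys l + 2%:R / n.+1%:R <= alpha].

Let ub_feasible : has_ubound feasible.
Proof. by exists 1 => l [+ _]; rewrite in_itv/= => /andP[]. Qed.

Lemma lambda_hat_infeasible : B < \sum_i base i ->
  lambda_hat pi pR cplus alpha xs ys = 0.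
Proof.
move=> Bbase; rewrite /lambda_hat -/feasible (_ : feasible = set0) ?sup0//.
rewrite -subset0 => l [/= + ]; rewrite in_itv/= => /andP[cl _].
rewrite calibration_loss_leE -/B leNgt => /negP; apply.
rewrite (lt_le_trans Bbase)// sum_monotone_lossE//; apply: ler_sum => i _.
by rewrite lerDl mulr_ge0//; case/andP: pR01.
Qed.

Hypothesis baseB : \sum_i base i <= B.

Let feasible_cplus : feasible cplus.
Proof.
split; first by rewrite in_itv/= lexx.
by rewrite calibration_loss_leE sum_monotone_loss_cplus.
Qed.

Lemma cplus_le_lambda_hat : cplus <= lambda_hat pi pR cplus alpha xs ys.
Proof. exact: ub_le_sup. Qed.

(** The total calibration loss is a nondecreasing step function, so it is constant
    on some interval ending at [u] and excluding it: the supremum of the feasible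
    thresholds is at least [u] if and only if the value on that interval is within
    budget. The loss at the supremum itself may exceed the budget. *)
Lemma le_lambda_hat u : cplus < u -> u <= 1 ->
  (u <= lambda_hat pi pR cplus alpha xs ys) = (below u <= B).
Proof.
move=> cu u1; apply/idP/idP => [ulam|uB].
  (* all the scores below u are at most v, so the loss is constant on [v, u[ *)
  pose v := \big[Num.max/cplus]_(i | (z i).1 < u) (z i).1.
  have vu : v < u by apply/bigmax_ltP; split.
  have [l [lc]] := sup_gt (ex_intro _ _ feasible_cplus) (lt_le_trans vu ulam).
  rewrite calibration_loss_leE -/B => lB vl; apply: le_trans lB.
  move: lc; rewrite in_itv/= => /andP[cl _].
  rewrite sum_monotone_lossE//; apply: ler_sum => i _; rewrite lerD2l.
  apply: ler_wpM2l; first by case/andP: pR01.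
  case: (jumps _ _) => //=; have [iu|_] := boolP ((z i).1 < u) => //=.
  by rewrite (le_trans (le_bigmax_cond _ _ iu) (ltW vl)).
rewrite leNgt; apply/negP => lamu.
(* a point strictly between the supremum and u would be feasible *)
pose l := (lambda_hat pi pR cplus alpha xs ys + u) / 2.
have laml : lambda_hat pi pR cplus alpha xs ys < l by rewrite midf_lt.
have lu : l < u by rewrite midf_lt.
have cl : cplus <= l := le_trans cplus_le_lambda_hat (ltW laml).
suff : feasible l by move/(ub_le_sup ub_feasible); rewrite leNgt laml.
split; first by rewrite in_itv/= cl (le_trans (ltW lu)).
rewrite calibration_loss_leE; apply: le_trans uB.
rewrite sum_monotone_lossE//; apply: ler_sum => i _; rewrite lerD2l.
apply: ler_wpM2l; first by case/andP: pR01.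
case: (jumps _ _) => //=; have [il|_] := boolP ((z i).1 <= l) => //=.
by rewrite (le_lt_trans il lu).
Qed.

End calibrated_threshold_value.

(** * Absence of ties *)

Section ties.
Context d (Omega : measurableType d) (R : realType) (P : probability Omega R).
Variables (V W : Omega -> R) (c : R).
Hypotheses (mV : measurable_fun setT V) (mW : measurable_fun setT W).
Hypothesis V01 : forall w, 0 <= V w <= 1.
Hypothesis indVW : forall A B : set R, measurable A -> measurable B ->
  P (V @^-1` A `&` W @^-1` B) = (P (V @^-1` A) * P (W @^-1` B))%E.
Hypothesis cV : forall a b, a <= b -> (P (V @^-1` `[a, b[) <= (c * (b - a))%:E)%E.
Hypothesis cW : forall a b, a <= b -> (P (W @^-1` `[a, b[) <= (c * (b - a))%:E)%E.

(** Cut [0, 1] into cells of length 1/N: a tie puts both variables in the same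
    cell, a given cell contains both with probability at most (c/N)^2, and the
    number of cells is of order N only. *)
Lemma ties_negligible : P.-negligible [set w | V w = W w].
Proof.
pose E := [set w | V w = W w].
have mE : measurable E.
  have := measurable_fun_eqr mV mW measurableT (Y := [set true]).
  rewrite setTI (_ : _ @^-1` _ = E); first by apply.
  by apply/seteqP; split => w /=; [move/eqP|move=> ->; rewrite eqxx].
have mpre (U : Omega -> R) (A : set R) : measurable_fun setT U ->
    measurable A -> measurable (U @^-1` A).
  by move=> mU mA; rewrite -[X in measurable X]setTI; exact: mU.
have PE N : (P E <= (2 * c ^+ 2 / N.+1%:R)%:E)%E.
  pose cell (k : nat) : set R := `[k%:R / N.+1%:R, k.+1%:R / N.+1%:R[%classic.
  pose F k := V @^-1` cell k `&` W @^-1` cell k.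
  have mcell k : measurable (cell k) by exact: measurable_itv.
  (* the value 1 lies in the cell of index N + 1, hence N + 2 cells *)
  have Ecell : E `<=` \big[setU/set0]_(k < N.+2) F k.
    move=> w Vw; rewrite -(bigcup_mkord _ F).
    have /andP[V0 V1] := V01 w.
    have NV0 : 0 <= V w * N.+1%:R by rewrite mulr_ge0.
    have /andP[kV Vk] := Num.Theory.truncn_itv NV0.
    exists (Num.truncn (V w * N.+1%:R)).
      rewrite /= Num.Theory.truncn_lt_nat//.
      by rewrite (@le_lt_trans _ _ N.+1%:R) ?ltr_nat// ler_piMl.
    have : cell (Num.truncn (V w * N.+1%:R)) (V w).
      by rewrite /cell/= in_itv/= ler_pdivrMr// kV/= ltr_pdivlMr.
    by split => //=; rewrite -Vw.
  apply: (@le_trans _ _ (\sum_(k < N.+2) P (F k))%E).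
    have mF k : measurable (F k) by apply: measurableI; exact: mpre.
    apply: le_trans (Boole_inequality P (fun k _ => mF k)).
    by apply: le_measure => //; rewrite inE//; exact: bigsetU_measurable.
  apply: (@le_trans _ _ (\sum_(k < N.+2) (c / N.+1%:R * (c / N.+1%:R))%:E)%E).
    apply: lee_sum => k _; rewrite /F indVW// EFinM.
    have kk : (k%:R / N.+1%:R : R) <= k.+1%:R / N.+1%:R.
      by rewrite ler_pM2r// ler_nat.
    have len : (k.+1%:R / N.+1%:R - k%:R / N.+1%:R : R) = N.+1%:R^-1.
      by rewrite -mulrBl -natrB// subSnn mul1r.
    apply: lee_pmul => //.
      by have := cV kk; rewrite len.
    by have := cW kk; rewrite len.
  rewrite sumEFin sumr_const card_ord lee_fin.
  rewrite (_ : c / _ * _ = c ^+ 2 / N.+1%:R / N.+1%:R); last first.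
    have : N.+1%:R != 0 :> R by [].
    by move: (N.+1%:R : R) => r r0; field.
  rewrite -[leLHS]mulr_natl !mulrA ler_pdivrMr// divfK// ler_pdivrMr//.
  have N2 : N.+2%:R <= 2 * N.+1%:R :> R.
    by rewrite -natrM ler_nat mul2n -addnn addSn ltnS -[N.+1]add0n leq_add.
  by have := sqr_ge0 c; nra.
apply/negligibleP => //; apply/eqP; rewrite eq_le measure_ge0 andbT.
apply/lee_addgt0Pr => e e0; rewrite add0e.
have [N] : exists N : nat, 2 * c ^+ 2 / e < N.+1%:R.
  exists (Num.truncn (2 * c ^+ 2 / e)).
  exact: Num.Theory.truncnS_gt.
rewrite ltr_pdivrMr// => Ne.
by rewrite (le_trans (PE N))// lee_fin ler_pdivrMr// [leRHS]mulrC ltW.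
Qed.

End ties.

(** * Scores and labels of the sample *)

Lemma iid_comp d (Omega : measurableType d) (R : realType)
    (P : probability Omega R) d1 d2 (T1 : measurableType d1)
    (T2 : measurableType d2) (I : finType) (Z : I -> Omega -> T1)
    (g : T1 -> T2) :
  measurable_fun setT g ->
  iid P Z -> iid P (fun i w => g (Z i w)).
Proof.
move=> mg [indZ idZ].
have mpre A : measurable A -> measurable (g @^-1` A).
  by move=> mA; rewrite -[X in measurable X]setTI; exact: mg.
split=> [J A mA|i j A mA]; last exact: (idZ i j _ (mpre _ mA)).
exact: (indZ J (fun i => g @^-1` A i) (fun i => mpre _ (mA i))).
Qed.

Lemma sum_not_ord_max (R : realType) n (F : 'I_n.+1 -> R) :
  \sum_(i | i != ord_max) F i = \sum_(i < n) F (widen_ord (leqnSn n) i).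
Proof.
rewrite big_mkcond big_ord_recr/= eqxx addr0; apply: eq_bigr => i _.
by rewrite ifT// neq_ltn /= ltn_ord.
Qed.

(** Only the positive part of [g] matters for an upper bound of its integral. *)
Lemma ae_le_integral_ge0 d (T : measurableType d) (R : realType)
    (mu : {measure set T -> \bar R}) (g h : T -> R) :
  measurable_fun setT g -> measurable_fun setT h -> (forall x, 0 <= h x) ->
  {ae mu, forall x, g x <= h x} ->
  (\int[mu]_x (g x)%:E <= \int[mu]_x (h x)%:E)%E.
Proof.
move=> mg mh h0 gh; rewrite integralE.
apply: (@le_trans _ _ (\int[mu]_x ((EFin \o g)^\+ x))%E).
  by rewrite -[leRHS]adde0 leeD2l// oppe_le0 integral_ge0.
apply: ae_ge0_le_integral => //.
- by apply: measurable_funepos; exact/measurable_EFinP.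
- by move=> x _; rewrite lee_fin.
- exact/measurable_EFinP.
by apply: filterS gh => x gx _; rewrite funeposE /= ge_max !lee_fin gx h0.
Qed.

Section cube.
Context (R : realType) (d : nat).

Lemma measurable_unit_cube : measurable (@unit_cube R d).
Proof.
rewrite (_ : @unit_cube R d = \bigcap_(j in [set: 'I_d])
    ((fun x : d.-tuple R => tnth x j) @^-1` `[0, 1])).
  apply: fin_bigcap_measurable => // j _.
  by rewrite -[X in measurable X]setTI; exact: measurable_tnth.
apply/seteqP; split => x /=; first by move=> xj j _ /=; rewrite in_itv/= xj.
by move=> xj j; have := xj j I; rewrite /= in_itv.
Qed.

Variables (pi : d.-tuple R -> R) (f : R -> R) (cminus cplus c : R).
Hypothesis mpi : measurable_fun (@unit_cube R d) pi.

Lemma measurable_score : measurable_fun (@unit_cube R d) (score pi).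
Proof. by apply: measurable_funB => //; exact: measurable_cst. Qed.

(** On the cube this is the pair of the score and the label; extending the score
    by 0 makes it measurable on the whole space. *)
Definition cube_score_label (z : d.-tuple R * bool) : measurableTypeR R * bool :=
  ((score pi \_ (@unit_cube R d)) z.1, z.2).

Lemma cube_score_labelE x y :
  unit_cube x -> cube_score_label (x, y) = score_label pi x y.
Proof. by move=> cx; rewrite /cube_score_label /= patchT// inE. Qed.

Lemma measurable_cube_score_label : measurable_fun setT cube_score_label.
Proof.
apply: measurable_fun_pair; last exact: measurable_snd.
apply: (measurableT_comp _ measurable_fst).
by apply/(measurable_restrictT _ measurable_unit_cube); exact: measurable_score.
Qed.

Hypothesis c0 : 0 < c.
Hypothesis densf : density_on_unit_interval (score pi) f.
Hypothesis fc : {ae lebesgue_measure, forall u : R,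
  u \in `[0, 1] -> u \notin `[cminus, cplus] -> c^-1 <= f u <= c}.
Hypothesis f0 : {ae lebesgue_measure, forall u : R,
  u \in `[cminus, cplus] -> f u = 0}.

(** The two almost everywhere conditions together say that the density is at most
    [c] on the whole of [0, 1]. *)
Lemma uniform_score_itv_le a b : a <= b ->
  (uniform_cube (score pi @^-1` `[a, b[) <= (c * (b - a))%:E)%E.
Proof.
move=> ab; have [mf fge0 ->] := densf; last exact: measurable_itv.
have mD : measurable (`[a, b[ `&` `[0%R, 1%R] : set R) by exact: measurableI.
apply: (@le_trans _ _ (\int[lebesgue_measure]_(u in `[a, b[ `&` `[0%R, 1%R]) c%:E)%E).
  apply: ae_ge0_le_integral => //.
  - by move=> u [_ u01]; rewrite lee_fin fge0.
  - by apply/measurable_EFinP; apply: measurable_funS mf.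
  - by move=> u _; rewrite lee_fin ltW.
  have FF := ae_filter_ringOfSetsType (@lebesgue_measure R).
  apply: filterS2 fc f0 => u fcu f0u [_ u01]; rewrite lee_fin.
  have [/f0u ->|/(fcu u01)/andP[]//] := boolP (u \in `[cminus, cplus]).
  exact: ltW.
rewrite integral_cst// EFinM lee_pmul2l// ?lte_fin//.
apply: (@le_trans _ _ (lebesgue_measure (`[a, b[%classic : set R))).
  by apply: le_measure => //; rewrite ?inE//; exact: subIsetl.
by rewrite lebesgue_measure_itv/= lte_fin; case: ltP; rewrite // lee_fin subr_ge0.
Qed.

Context disp (Omega : measurableType disp) (P : probability Omega R).
Variable X : Omega -> d.-tuple R.
Hypothesis uX : uniform_on_cube P X.

Lemma probability_score B : measurable B ->
  P ((fun w => score pi (X w)) @^-1` B) = uniform_cube (score pi @^-1` B).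
Proof.
move=> mB; have [cX lawX] := uX.
rewrite (_ : _ @^-1` B = X @^-1` (@unit_cube R d `&` score pi @^-1` B)).
  rewrite lawX /uniform_cube; last first.
    by apply: measurable_score => //; exact: measurable_unit_cube.
  by rewrite setIAC setIid setIC.
by apply/seteqP; split => w //= [].
Qed.

End cube.

(** * Conformal risk control *)

Section risk_control.
Context (R : realType) (d n : nat) (disp : measure_display)
  (Omega : measurableType disp) (P : probability Omega R).
Variables (X : 'I_n.+1 -> {RV P >-> d.-tuple R}) (Y : 'I_n.+1 -> {RV P >-> bool}).
Variables (eta : d.-tuple R -> R) (pR : R) (pi : d.-tuple R -> R).
Variables (cminus cplus : R) (f : R -> R) (c : R) (alpha : R).
Hypothesis iidXY : iid P (fun i w => (X i w, Y i w)).
Hypothesis uX : forall i, uniform_on_cube P (X i).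
Hypothesis pR01 : 0 <= pR <= 1.
Hypothesis meta : measurable_fun (@unit_cube R d) eta.
Hypothesis mpi : measurable_fun (@unit_cube R d) pi.
Hypothesis pi01 : forall x, unit_cube x -> 0 <= pi x <= 1.
Hypotheses (cplus0 : 0 <= cplus) (cplus1 : cplus <= 1).

Let Z i w : measurableTypeR R * bool := score_label pi (X i w) (Y i w).
Let lam := lambda_diamond pi pR cplus alpha X Y.
Let B : R := n.+1%:R * alpha - 2.
Let base := base_loss pR cplus.
Let calibration w := \sum_(i < n) base (Z (widen_ord (leqnSn n) i) w).
Let below w :=
  loss_below_of base fst (jumps cplus) pR (sample Z 1 w) (@ord_max n).
Let test_score w := score pi (X ord_max w).

Let ZE i : Z i = cube_score_label pi \o (fun w => (X i w, Y i w)).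
Proof.
by apply/funext => w /=; rewrite cube_score_labelE//; exact: (uX i).1.
Qed.

Let mZ i : measurable_fun setT (Z i).
Proof.
rewrite ZE; apply: (measurableT_comp (measurable_cube_score_label mpi)).
by apply: measurable_fun_pair; exact: measurable_funP.
Qed.

Let iidZ : iid P Z.
Proof.
have -> : Z = fun i w => cube_score_label pi (X i w, Y i w).
  by apply/funext => i; rewrite ZE.
exact: (iid_comp (measurable_cube_score_label mpi) iidXY).
Qed.

Let score01 i w : 0 <= (Z i w).1 <= 1.
Proof. by rewrite /= /score; have := pi01 ((uX i).1 w); lra. Qed.

Let mfstZ i : measurable_fun setT (fun w => (Z i w).1).
Proof. exact: (measurableT_comp (@measurable_fst _ _ _ _) (mZ i)). Qed.

Let mbase : measurable_fun setT base.
Proof.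
have mc (g : measurableTypeR R * bool -> bool) := @measurable_natr_bool _ _ R g.
apply: measurable_funD; [|apply: measurable_funM; first exact: measurable_cst];
  apply: mc.
  apply: measurable_and; last exact: (measurable_neg measurable_snd).
  by apply: measurable_fun_ler; [exact: measurable_fst|exact: measurable_cst].
by apply: measurable_fun_ltr; [exact: measurable_cst|exact: measurable_fst].
Qed.

Let mjumps : measurable_fun setT (jumps cplus).
Proof.
apply: measurable_and; last exact: (measurable_neg measurable_snd).
by apply: measurable_fun_ltr; [exact: measurable_cst|exact: measurable_fst].
Qed.

Let mcalibration : measurable_fun setT calibration.
Proof. by apply: measurable_sum => i; exact: (measurableT_comp mbase (mZ _)). Qed.

Let feasible w := calibration w <= B.

Let mfeasible : measurable_fun setT feasible.
Proof. by apply: measurable_fun_ler => //; exact: measurable_cst. Qed.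

(** The threshold is a supremum, but the event that it reaches the test score is
    decided by finite sums, which makes it measurable. When even [cplus] is over
    budget, the threshold is the supremum of the empty set, which is 0. *)
Let reached w := if feasible w then (test_score w <= cplus) || (below w <= B)
  else test_score w <= 0.

Let belowE w : below w =
  loss_below (fun i : 'I_n => base (Z (widen_ord (leqnSn n) i) w))
    (fun i => (Z (widen_ord (leqnSn n) i) w).1)
    (fun i => jumps cplus (Z (widen_ord (leqnSn n) i) w)) pR predT
    (test_score w).
Proof.
rewrite /below /loss_below_of /loss_below sum_not_ord_max.
by apply: eq_bigr => i _; rewrite !tnth_mktuple !perm1.
Qed.

Let lam_feasible w : feasible w -> cplus <= lam w.
Proof. by move=> fw; apply: cplus_le_lambda_hat. Qed.

Let lam_infeasible w : ~~ feasible w -> lam w = 0.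
Proof. by rewrite -ltNge => fw; apply: lambda_hat_infeasible. Qed.

Let reachedE w : (test_score w <= lam w) = reached w.
Proof.
rewrite /reached; case: ifPn => [fw|/lam_infeasible -> //].
have [sc|cs] := leP (test_score w) cplus.
  by rewrite (le_trans sc)//; exact: lam_feasible.
have /andP[_ s1] := score01 ord_max w.
by rewrite /lam /lambda_diamond le_lambda_hat// belowE.
Qed.

Let mtest_score : measurable_fun setT test_score := mfstZ ord_max.

Let mbelow : measurable_fun setT below.
Proof.
exact: (measurableT_comp (measurable_loss_below_of pR mbase measurable_fst
  mjumps ord_max) (measurable_sample mZ 1)).
Qed.

Let mreached : measurable_fun setT reached.
Proof.
apply: measurable_fun_ifT => //.
  by apply: measurable_or; apply: measurable_fun_ler => //; exact: measurable_cst.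
by apply: measurable_fun_ler => //; exact: measurable_cst.
Qed.

Let test_loss w :=
  monotone_loss pi pR cplus (lam w) (X ord_max w) (Y ord_max w).

Let test_lossE w : test_loss w =
  if feasible w || (cplus <= 0) then
    base (Z ord_max w) + pR * (jumps cplus (Z ord_max w) && reached w)%:R
  else 0.
Proof.
rewrite -reachedE; case: ifPn => [fc|].
  apply: monotone_lossE => //; have [/lam_feasible//|nf] := boolP (feasible w).
  by move: fc; rewrite (negbTE nf) lam_infeasible.
(* the threshold 0 is below cplus, so the monotone loss is a supremum over an
   empty interval *)
rewrite negb_or => /andP[nf cplus_gt0].
rewrite /test_loss lam_infeasible// /monotone_loss.
rewrite (_ : [set` `[cplus, 0]] = set0) ?image_set0 ?sup0//.
by apply: set_itv_ge; rewrite bnd_simp.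
Qed.

Let mtest_loss : measurable_fun setT test_loss.
Proof.
rewrite (_ : test_loss = fun w => if feasible w || (cplus <= 0) then
    base (Z ord_max w) + pR * (jumps cplus (Z ord_max w) && reached w)%:R
  else 0); last by apply/funext => w; rewrite test_lossE.
apply: measurable_fun_ifT; last exact: measurable_cst.
  by apply: measurable_or => //; exact: measurable_cst.
apply: measurable_funD; first exact: (measurableT_comp mbase (mZ _)).
apply: measurable_funM; first exact: measurable_cst.
apply: measurable_natr_bool; apply: measurable_and => //.
exact: (measurableT_comp mjumps (mZ _)).
Qed.

Let test_loss_ge0 w : 0 <= test_loss w.
Proof. exact: monotone_loss_ge0. Qed.

Let calibrationE w : \sum_(i < n) monotone_loss pi pR cplus cplus
    (calibration_data X w i) (calibration_data Y w i) = calibration w.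
Proof. exact: sum_monotone_loss_cplus. Qed.

Hypothesis cal : P [set w | calibration_loss pi pR cplus
    (calibration_data X w) (calibration_data Y w) cplus
  <= alpha - 3%:R / n.+1%:R] = 1%E.

Let ae_feasible : {ae P, forall w, feasible w}.
Proof.
have setE : [set w | calibration_loss pi pR cplus (calibration_data X w)
    (calibration_data Y w) cplus <= alpha - 3%:R / n.+1%:R] =
    [set w | calibration w <= n.+1%:R * alpha - 3].
  by apply/funext => w /=; rewrite lerBrDr calibration_loss_leE calibrationE.
have mset : measurable [set w | calibration w <= n.+1%:R * alpha - 3].
  rewrite -[X in measurable X]setTI.
  have := measurable_fun_ler mcalibration
    (measurable_cst (n.+1%:R * alpha - 3) : measurable_fun setT _).
  by move=> /(_ measurableT [set true]); apply.
exists (~` [set w | calibration w <= n.+1%:R * alpha - 3]); split.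
- exact: measurableC.
- by rewrite probability_setC// -setE cal subee.
- move=> w /=; apply: contra_not => calw; rewrite /feasible (le_trans calw)//.
  by rewrite /B lerB// ler_nat.
Qed.

(** The inequality already holds pointwise once [cplus] is within budget: a
    selected point contributes at most [pR] to the risk if its label is 0, and then
    its loss is 1; it contributes at most 0 if its label is 1. *)
Lemma type1_risk_le_loss :
  (expected_type1_risk P pi eta pR lam (X ord_max) (Y ord_max)
    <= 'E_P[test_loss])%E.
Proof.
pose bad w := reached w && (eta (X ord_max w) < pR).
pose risk w := (pR - (Y ord_max w)%:R) * (bad w)%:R.
have -> : expected_type1_risk P pi eta pR lam (X ord_max) (Y ord_max) =
    ('E_P[risk])%E.
  rewrite /expected_type1_risk; congr ('E_P[ _ ])%E; apply/funext => w.
  rewrite /risk indicE; congr (_ * (nat_of_bool _)%:R).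
  have cX := (uX ord_max).1 w.
  rewrite /bad -reachedE; apply/idP/idP.
    rewrite inE => -[[_ /= s_lam] nrel].
    rewrite /test_score /score lerBlDr -lerBlDl s_lam/=.
    by rewrite ltNge; apply/negP => le; apply: nrel; split.
  move=> /andP[s_lam]; rewrite ltNge => /negP neta; rewrite inE; split.
    by split => //=; move: s_lam; rewrite /test_score /score lerBlDr -lerBlDl.
  by move=> [].
rewrite unlock; apply: ae_le_integral_ge0 => //.
  apply: measurable_funM.
    apply: measurable_funB; first exact: measurable_cst.
    by apply: measurable_natr_bool; exact: measurable_funP.
  apply: measurable_natr_bool; apply: measurable_and => //.
  apply: measurable_fun_ltr; last exact: measurable_cst.
  apply: (measurable_comp (@measurable_unit_cube R d) _ meta).
    by move=> _ [w _ <-]; exact: (uX ord_max).1.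
  exact: measurable_funP.
apply: filterS ae_feasible => w fw; rewrite /risk.
have [|_] := boolP (bad w); last by rewrite mulr0.
move=> /andP[rw _]; rewrite mulr1 test_lossE fw rw /= andbT.
have [pR0 pR1] := andP pR01.
have := base_loss_ge0 cplus pR01 (Z ord_max w).
rewrite /base /base_loss /jumps /=.
by case: (Y ord_max w); case: (lerP (score pi _) cplus) => _ /=; lra.
Qed.

Hypothesis c0 : 0 < c.
Hypothesis densf : density_on_unit_interval (score pi) f.
Hypothesis fc : {ae lebesgue_measure, forall u : R,
  u \in `[0, 1] -> u \notin `[cminus, cplus] -> c^-1 <= f u <= c}.
Hypothesis f0 : {ae lebesgue_measure, forall u : R,
  u \in `[cminus, cplus] -> f u = 0}.

Let noties i j : i != j -> P.-negligible [set w | (Z i w).1 = (Z j w).1].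
Proof.
move=> ij; apply: (@ties_negligible _ _ _ P (fun w => (Z i w).1)
  (fun w => (Z j w).1) c) => //.
- exact: mfstZ.
- exact: mfstZ.
- move=> A1 A2 mA1 mA2.
  pose A k : set (measurableTypeR R * bool) :=
    if k == i then A1 `*` setT else A2 `*` setT.
  have mA k : measurable (A k) by rewrite /A; case: ifP => _; exact: measurableX.
  have := iidZ.1 [set i; j]%SET A mA.
  have ji : (j == i) = false by rewrite eq_sym (negbTE ij).
  rewrite big_setU1/= ?inE// big_set1 {2 3}/A eqxx ji.
  have fstE k (C : set R) :
      Z k @^-1` (C `*` setT) = (fun w => (Z k w).1) @^-1` C.
    by apply/seteqP; split => w //= [].
  rewrite !fstE => <-; congr (P _); apply/seteqP; split => w /=.
    move=> [w1 w2] k; rewrite /= !inE => /orP[]/eqP ->; rewrite /A ?eqxx ?ji //.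
  move=> wA; have := wA i; have := wA j.
  rewrite /= !inE !eqxx orbT /A eqxx ji => /(_ isT)[+ _] /(_ isT)[+ _].
  by split.
- move=> a b ab; rewrite (probability_score mpi (uX i))//.
  exact: uniform_score_itv_le c0 densf fc f0 _ _ ab.
- move=> a b ab; rewrite (probability_score mpi (uX j))//.
  exact: uniform_score_itv_le c0 densf fc f0 _ _ ab.
Qed.

(** Almost surely the test loss is the held-out loss of the last observation. The
    budget [B] is [n.+1 * alpha - 2], so the leave-one-out bound gives
    [alpha - 1 / n.+1]. *)
Lemma expected_loss_le : ('E_P[test_loss] <= alpha%:E)%E.
Proof.
have [pR0 pR1] := andP pR01.
rewrite unlock; apply: (@le_trans _ _ ((B + 1) / n.+1%:R)%:E); last first.
  by rewrite lee_fin ler_pdivrMr// /B; lra.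
have bound := @expectation_held_out_loss_le _ _ _ P _ _ n Z mZ iidZ base fst
  (jumps cplus) pR B mbase measurable_fst mjumps pR0.
apply: le_trans (bound _ _ _ _ _) => //.
- apply: ae_le_integral_ge0 => //.
  + exact: (measurableT_comp (measurable_held_out_loss_of pR B mbase
      measurable_fst mjumps ord_max) (measurable_sample mZ 1)).
  + move=> w; rewrite addr_ge0 ?mulr_ge0//; exact: base_loss_ge0.
  apply: filterS ae_feasible => w fw; rewrite test_lossE fw /=.
  rewrite /held_out_loss_of /held_out_loss.
  rewrite -[loss_below _ _ _ _ _ _]/(below w) !tnth_mktuple !perm1.
  rewrite lerD2l ler_wpM2l// /reached fw /jumps /test_score /=.
  by case: (lerP (score pi (X ord_max w)) cplus).
- by move=> z; exact: base_loss_ge0.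
- by move=> z; exact: base_loss_le1.
- by move=> z jz; rewrite /base (base_loss_jumps pR jz); lra.
by apply: filterS ae_feasible => w; rewrite sum_not_ord_max.
Qed.

End risk_control.

Theorem theorem3 (R : realType) (d n : nat)
    (disp : measure_display) (Omega : measurableType disp)
    (P : probability Omega R)
    (X : 'I_n.+1 -> {RV P >-> d.-tuple R}) (Y : 'I_n.+1 -> {RV P >-> bool})
    (eta : d.-tuple R -> R) (pR : R)
    (pi : d.-tuple R -> R) (cminus cplus : R) (f : R -> R) (c : R) (alpha : R) :
  iid P (fun i w => (X i w, Y i w)) ->
  (forall i, uniform_on_cube P (X i)) ->
  (forall i, success_probability P eta (X i) (Y i)) ->
  0 < pR < 1 ->
  (0 < lebesgue_tuple R d (reliability_set eta pR))%E ->
  (0 < lebesgue_tuple R d (@unit_cube R d `\` reliability_set eta pR))%E ->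
  lebesgue_tuple R d [set x | unit_cube x /\ eta x = pR] = 0%E ->
  measurable_fun (@unit_cube R d) pi ->
  (forall x, unit_cube x -> 0 <= pi x <= 1) ->
  0 <= cminus -> cminus <= cplus -> cplus <= 1 ->
  density_on_unit_interval (score pi) f ->
  {within `[0, cminus[, continuous f} ->
  {within `]cplus, 1], continuous f} ->
  0 < c ->
  {ae lebesgue_measure, forall u : R,
     u \in `[0, 1] -> u \notin `[cminus, cplus] -> c^-1 <= f u <= c} ->
  {ae lebesgue_measure, forall u : R, u \in `[cminus, cplus] -> f u = 0} ->
  0 < alpha ->
  P [set w | calibration_loss pi pR cplus
               (calibration_data X w) (calibration_data Y w) cplus
             <= alpha - 3%:R / n.+1%:R] = 1%E ->
  (expected_type1_risk P pi eta pR (lambda_diamond pi pR cplus alpha X Y)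
       (X ord_max) (Y ord_max)
     <= 'E_P[fun w => monotone_loss pi pR cplus (lambda_diamond pi pR cplus alpha X Y w)
                        (X ord_max w) (Y ord_max w)])%E
  /\
  ('E_P[fun w => monotone_loss pi pR cplus (lambda_diamond pi pR cplus alpha X Y w)
                   (X ord_max w) (Y ord_max w)] <= alpha%:E)%E.
Proof.
move=> iidXY uX succ /andP[pR0 pR1] _ _ _ mpi pi01 cm0 cmcp cp1 densf _ _ c0.
move=> fc f0 _ cal.
have pR01 : 0 <= pR <= 1 by rewrite !ltW.
have cp0 : 0 <= cplus := le_trans cm0 cmcp.
have [meta _ _] := succ ord_max.
split.
  exact: (@type1_risk_le_loss _ _ _ _ _ P X Y eta pR pi cplus alpha).
exact: (@expected_loss_le _ _ _ _ _ P X Y pR pi cminus cplus f c alpha).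
Qed.
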